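(* Let $G$ be an abelian group, $\mathbb{F}$ a field, $\mathcal{D}$ a $G$-graded associative $\mathbb{F}$-algebra which is a graded-division algebra, with grading $\Gamma_0$ and support $T$, and $\mathcal{V}$ a nonzero $G$-graded right $\mathcal{D}$-module of finite dimension $k$ over $\mathcal{D}$. Let $\Gamma$ be the induced $G$-grading on $\mathcal{R}=\operatorname{End}_{\mathcal{D}}(\mathcal{V})$. Assume that $(\mathcal{D},\mathcal{V})$ satisfies the fine condition. Then the diagonal group of $\Gamma$ is isomorphic to $$\operatorname{Diag}(\Gamma)\cong(\mathbb{F}^{\times})^{k-1}\times\operatorname{Diag}(\Gamma_0).$$
   Context: A graded-division algebra is a (nonzero) unital graded associative algebra in which every nonzero homogeneous element is invertible; its support $T=\{g\in G\mid\mathcal{D}_g\neq0\}$ is a subgroup of $G$. A $G$-graded right $\mathcal{D}$-module is $\mathcal{V}=\bigoplus_{g\in G}\mathcal{V}_g$ with $\mathcal{V}_g\mathcal{D}_h\subseteq\mathcal{V}_{gh}$; it is free with a homogeneous $\mathcal{D}$-basis. $\operatorname{End}_{\mathcal{D}}(\mathcal{V})$ is graded by: $r$ has degree $g$ if $r\mathcal{V}_h\subseteq\mathcal{V}_{gh}$ for all $h\in G$. The isotypic components of $\mathcal{V}$ are the nonzero subspaces among $\bigoplus_{h\in gT}\mathcal{V}_h$, $gT\in G/T$; let $g_1T,\dots,g_sT$ be their (distinct) supports and $k_1,\dots,k_s$ their $\mathcal{D}$-dimensions, so $k=k_1+\dots+k_s$. The pair $(\mathcal{D},\mathcal{V})$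 satisfies the fine condition if $k_1=\dots=k_s=1$ and $g_ig_j^{-1}\not\equiv g_hg_\ell^{-1}\pmod T$ for all $i\neq j$ and $(i,j)\neq(h,\ell)$. For a grading $\Gamma$ on an $\mathbb{F}$-algebra $\mathcal{R}$, $\operatorname{Diag}(\Gamma)$ is the group of $\mathbb{F}$-algebra automorphisms $\psi$ of $\mathcal{R}$ such that on each nonzero homogeneous component $\mathcal{R}_g$ the map $\psi$ is multiplication by some scalar in $\mathbb{F}^{\times}$; similarly for $\Gamma_0$ on $\mathcal{D}$. *)

(* Defs.v *)
From HB Require Import structures.
From mathcomp Require Import all_boot all_order all_algebra.
From mathcomp Require Import boolp functions.

Set Implicit Arguments.
Unset Strict Implicit.
Unset Printing Implicit Defensive.

Import GRing.Theory.
Local Open Scope ring_scope.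

(* The grading group G is abelian and written additively; a family of
   homogeneous components is a function W_ : G -> {pred W}.  Since boolp makes
   every proposition decidable, {pred W} stands for arbitrary subsets of W. *)

Section DirectSum.
Variables (G : zmodType) (W : zmodType) (W_ : G -> {pred W}).

Definition is_direct_sum : Prop :=
  [/\ forall g, zmod_closed (W_ g),
      forall w : W, exists (s : seq G) (x : G -> W),
        (forall g, x g \in W_ g) /\ w = \sum_(g <- s) x g
    & forall (s : seq G) (x : G -> W),
        uniq s -> (forall g, x g \in W_ g) ->
        \sum_(g <- s) x g = 0 -> forall g, g \in s -> x g = 0].

Definition in_support (g : G) : Prop := exists2 w, w \in W_ g & w != 0.

End DirectSum.

Section GradedAlgebra.
Variables (G : zmodType) (F : fieldType) (A : algType F) (A_ : G -> {pred A}).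

Definition is_algebra_grading : Prop :=
  [/\ is_direct_sum A_,
      forall g, submod_closed (A_ g)
    & forall g h x y, x \in A_ g -> y \in A_ h -> x * y \in A_ (g + h)].

(* An algType is a nonzero algebra, so 1 != 0 need not be required. *)
Definition is_graded_division : Prop :=
  forall g x, x \in A_ g -> x != 0 -> exists y, x * y = 1 /\ y * x = 1.

End GradedAlgebra.

(* A right D-module is a left module over the converse ring D^c.  Its F-vector
   space structure is the one it inherits from D, namely v |-> v *r c%:A. *)
Definition ract (F : fieldType) (D : algType F) (V : lmodType D^c)
  (v : V) (d : D) : V := (d : D^c) *: v.

Notation "v *r d" := (ract v d) (at level 40, left associativity) : ring_scope.

Section GradedModule.
Variables (G : zmodType) (F : fieldType) (D : algType F) (V : lmodType D^c).
Variables (D_ : G -> {pred D}) (V_ : G -> {pred V}).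

Definition is_module_grading : Prop :=
  is_direct_sum V_ /\
  forall g h v d, v \in V_ g -> d \in D_ h -> v *r d \in V_ (g + h).

(* W (a graded submodule of V) has a homogeneous D-basis with n elements. *)
Definition has_dim (W : {pred V}) (n : nat) : Prop :=
  exists b : 'I_n -> V,
    [/\ forall i, b i \in W,
        forall i, exists g, b i \in V_ g
      & forall w, w \in W ->
          exists! d : {ffun 'I_n -> D}, w = \sum_(i < n) b i *r d i].

(* Congruence modulo the support T of D. *)
Definition cong_supp (g h : G) : Prop := in_support D_ (g - h).

(* The sum of the V_h over h in the coset gT; it is an isotypic component of V
   when it is nonzero. *)
Definition isotypic (g : G) : {pred V} := fun v =>
  `[< exists (s : seq G) (x : G -> V),
        [/\ forall h, h \in s -> cong_supp h g,
            forall h, x h \in V_ h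
          & v = \sum_(h <- s) x h] >].

Definition isotypic_nonzero (g : G) : Prop :=
  exists2 v, v \in isotypic g & v != 0.

(* g_1 T, ..., g_s T are the distinct supports of the isotypic components. *)
Definition isotypic_supports (s : nat) (g : 'I_s -> G) : Prop :=
  [/\ forall i j, cong_supp (g i) (g j) -> i = j,
      forall i, isotypic_nonzero (g i)
    & forall h, isotypic_nonzero h -> exists i, cong_supp h (g i)].

Definition fine_condition : Prop :=
  exists (s : nat) (g : 'I_s -> G),
    [/\ isotypic_supports g,
        forall i, has_dim (isotypic (g i)) 1
      & forall i j h l, i != j -> (i, j) != (h, l) ->
          ~ cong_supp (g i - g j) (g h - g l)].

End GradedModule.

Section EndD.
Variables (F : fieldType) (D : algType F) (V : lmodType D^c).

Definition D_linear : {pred V -> V} := fun r => `[< linear r >].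

Fact D_linear_zmod_closed : zmod_closed D_linear.
Proof.
split=> [|r r' /asboolP lr /asboolP lr']; apply/asboolP => a u v.
  by rewrite /GRing.zero/= scaler0 addr0.
rewrite -!/(_ - _) /= -![(r - r') _]/(r _ - r' _) lr lr' scalerBr opprD.
by rewrite addrACA.
Qed.

HB.instance Definition _ :=
  GRing.isZmodClosed.Build (V -> V) D_linear D_linear_zmod_closed.

(* End_D(V).  The (proof-irrelevant) argument stating that V is nonzero is what
   makes it a nonzero ring, as required of an algType. *)
Definition endD (_ : exists v : V, v != 0) := {r : V -> V | r \in D_linear}.

Variable (V_neq0 : exists v : V, v != 0).
Local Notation R := (endD V_neq0).

HB.instance Definition _ := SubChoice.on R.
HB.instance Definition _ := [SubChoice_isSubZmodule of R by <:].

Implicit Types r : R.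

Lemma endD_linear r : linear (val r).
Proof. by apply/asboolP; exact: (valP r). Qed.

Lemma endD_eq r r' : (forall v, val r v = val r' v) -> r = r'.
Proof. by move=> e; apply/val_inj/funext. Qed.

Fact endD_one_subproof : (id : V -> V) \in D_linear.
Proof. by apply/asboolP => a u v. Qed.

Definition endD_one : R := Sub (id : V -> V) endD_one_subproof.

Fact endD_mul_subproof r r' : (val r \o val r') \in D_linear.
Proof. by apply/asboolP => a u v /=; rewrite !endD_linear. Qed.

Definition endD_mul r r' : R := Sub (val r \o val r') (endD_mul_subproof r r').

Fact endD_scale_subproof (c : F) r :
  (fun v => val r v *r c%:A) \in D_linear.
Proof.
apply/asboolP => a u v /=; rewrite endD_linear /ract scalerDr !scalerA.
congr (_ *: _ + _); rewrite -[LHS]/((a : D) * c%:A) -[RHS]/(c%:A * (a : D)).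
by rewrite mulr_algl mulr_algr.
Qed.

Definition endD_scale (c : F) r : R :=
  Sub (fun v => val r v *r c%:A) (endD_scale_subproof c r).

Let addE r r' v : val (r + r') v = val r v + val r' v.
Proof. by rewrite raddfD. Qed.

Fact endD_addf r u v : val r (u + v) = val r u + val r v.
Proof. by have := endD_linear r 1 u v; rewrite !scale1r. Qed.

Fact endD_scalef r (d : D^c) u : val r (d *: u) = d *: val r u.
Proof.
have r0 : val r 0 = 0.
  by have := endD_addf r 0 0; rewrite addr0 -[LHS]addr0 => /addrI.
by have := endD_linear r d u 0; rewrite !addr0 r0 addr0.
Qed.

Fact endD_mulA : associative endD_mul.
Proof. by move=> r1 r2 r3; apply: endD_eq. Qed.
Fact endD_mul1 : left_id endD_one endD_mul.
Proof. by move=> r; apply: endD_eq. Qed.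
Fact endD_1mul : right_id endD_one endD_mul.
Proof. by move=> r; apply: endD_eq. Qed.
Fact endD_mulDl : left_distributive endD_mul +%R.
Proof. by move=> r1 r2 r3; apply: endD_eq => v; rewrite addE. Qed.
Fact endD_mulDr : right_distributive endD_mul +%R.
Proof.
move=> r1 r2 r3; apply: endD_eq => v.
by rewrite addE -[LHS]/(val r1 (val (r2 + r3) v)) addE endD_addf.
Qed.
Fact endD_1neq0 : endD_one != 0.
Proof.
apply/eqP => /(congr1 val) /= e; case: V_neq0 => v /eqP; apply.
by rewrite -[v in LHS]/(id v) e.
Qed.

HB.instance Definition _ := GRing.Zmodule_isNzRing.Build R
  endD_mulA endD_mul1 endD_1mul endD_mulDl endD_mulDr endD_1neq0.

Fact endD_scalerA a b r : endD_scale a (endD_scale b r) = endD_scale (a * b) r.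
Proof.
apply: endD_eq => v /=; rewrite /ract scalerA; congr (_ *: _).
by rewrite -[LHS]/((b%:A : D) * a%:A) mulr_algr scalerA.
Qed.
Fact endD_scale1r : left_id 1 endD_scale.
Proof. by move=> r; apply: endD_eq => v /=; rewrite /ract !scale1r. Qed.
Fact endD_scalerDr : right_distributive endD_scale +%R.
Proof.
move=> a r r'; apply: endD_eq => v.
by rewrite addE -[LHS]/(val (r + r') v *r a%:A) addE /ract scalerDr.
Qed.
Fact endD_scalerDl r : {morph endD_scale^~ r : a b / a + b}.
Proof.
move=> a b; apply: endD_eq => v.
by rewrite addE /= /ract -scalerDl; congr (_ *: _); exact: scalerDl.
Qed.

HB.instance Definition _ := GRing.Zmodule_isLmodule.Build F R
  endD_scalerA endD_scale1r endD_scalerDr endD_scalerDl.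

Fact endD_scalerAl (a : F) (r r' : R) : a *: (r * r') = (a *: r) * r'.
Proof. by apply: endD_eq. Qed.
Fact endD_scalerAr (a : F) (r r' : R) : a *: (r * r') = r * (a *: r').
Proof. by apply: endD_eq => v /=; rewrite /ract endD_scalef. Qed.

HB.instance Definition _ := GRing.Lmodule_isLalgebra.Build F R endD_scalerAl.
HB.instance Definition _ := GRing.Lalgebra_isAlgebra.Build F R endD_scalerAr.

(* r has degree g if r V_h is contained in V_(g + h) for all h. *)
Definition end_grading (G : zmodType) (V_ : G -> {pred V}) (g : G) : {pred R} :=
  fun r => `[< forall h v, v \in V_ h -> val r v \in V_ (g + h) >].

End EndD.

Section AlgebraAutomorphisms.
Variables (F : fieldType) (A : algType F).

Definition is_alg_aut : {pred A -> A} :=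
  fun f => `[< [/\ linear f, monoid_morphism f & bijective f] >].

Definition alg_aut := {f : A -> A | f \in is_alg_aut}.

HB.instance Definition _ := SubChoice.on alg_aut.

Implicit Types f : alg_aut.

Lemma alg_autP f :
  [/\ linear (val f), monoid_morphism (val f) & bijective (val f)].
Proof. by apply/asboolP; exact: (valP f). Qed.

Lemma alg_autZ f a x : val f (a *: x) = a *: val f x.
Proof.
have [lf _ _] := alg_autP f.
have f0 : val f 0 = 0.
  by have := lf 1 0 0; rewrite scale1r addr0 scale1r -[LHS]addr0 => /addrI.
by have := lf a x 0; rewrite !addr0 f0 addr0.
Qed.

Fact alg_aut_one_subproof : (id : A -> A) \in is_alg_aut.
Proof. by apply/asboolP; split=> //; exists id. Qed.

Definition alg_aut_one : alg_aut := Sub (id : A -> A) alg_aut_one_subproof.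

Fact alg_aut_mul_subproof f f' : (val f \o val f') \in is_alg_aut.
Proof.
have [lf [f1 fM] bf] := alg_autP f; have [lf' [f'1 f'M] bf'] := alg_autP f'.
apply/asboolP; split; last exact: bij_comp.
- by move=> a u v /=; rewrite lf' lf.
- by split=> [|x y] /=; rewrite ?f'1 ?f'M ?f1 ?fM.
Qed.

Definition alg_aut_mul f f' : alg_aut :=
  Sub (val f \o val f') (alg_aut_mul_subproof f f').

Fact alg_aut_inv_ex f :
  exists g : alg_aut, cancel (val f) (val g) /\ cancel (val g) (val f).
Proof.
have [lf [f1 fM] bf] := alg_autP f; case: (bf) => h fK hK.
have hP : h \in is_alg_aut.
  apply/asboolP; split; last by exists (val f).
  - by move=> a u v; apply: (bij_inj bf); rewrite lf !hK.
  - by split=> [|x y]; apply: (bij_inj bf); rewrite ?fM !hK.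
by exists (Sub h hP).
Qed.

Definition alg_aut_inv f : alg_aut := projT1 (cid (alg_aut_inv_ex f)).

Fact alg_aut_mulA : associative alg_aut_mul.
Proof. by move=> f g h; apply: val_inj. Qed.
Fact alg_aut_mul1 : left_id alg_aut_one alg_aut_mul.
Proof. by move=> f; apply: val_inj. Qed.
Fact alg_aut_1mul : right_id alg_aut_one alg_aut_mul.
Proof. by move=> f; apply: val_inj. Qed.
Fact alg_aut_mulV : left_inverse alg_aut_one alg_aut_inv alg_aut_mul.
Proof.
move=> f; apply/val_inj/funext => x; rewrite /alg_aut_inv /=.
by case: cid => g [] /=.
Qed.
Fact alg_aut_Vmul : right_inverse alg_aut_one alg_aut_inv alg_aut_mul.
Proof.
move=> f; apply/val_inj/funext => x; rewrite /alg_aut_inv /=.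
by case: cid => g [] /=.
Qed.

HB.instance Definition _ := isGroup.Build alg_aut
  alg_aut_mulA alg_aut_mul1 alg_aut_1mul alg_aut_mulV alg_aut_Vmul.

Variables (G : zmodType) (A_ : G -> {pred A}).

Definition is_diag : {pred alg_aut} := fun f =>
  `[< forall g, in_support A_ g ->
        exists2 c : F, c != 0 & forall x, x \in A_ g -> val f x = c *: x >].

Definition Diag := {f : alg_aut | f \in is_diag}.

Fact is_diag_group_closed : group_closed is_diag.
Proof.
split=> [|f f' /asboolP df /asboolP df'].
  by apply/asboolP => g _; exists 1; rewrite ?oner_neq0// => x _; rewrite scale1r.
apply/asboolP => g Ag; have [c c0 fE] := df g Ag; have [c' c'0 f'E] := df' g Ag.
exists (c / c'); first by rewrite mulf_neq0 ?invr_eq0.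
move=> x xg.
have [_ _ bf'] := alg_autP f'.
have -> : val (f / f')%g x = val f (val f'^-1%g x) by [].
have -> : val f'^-1%g x = c'^-1 *: x.
  apply: (bij_inj bf'); rewrite alg_autZ (f'E x) // scalerA mulVf // scale1r.
  by have := congr1 (fun h : alg_aut => val h x) (mulgV f').
by rewrite alg_autZ (fE x) // scalerA mulrC.
Qed.

HB.instance Definition _ := SubChoice.on Diag.
HB.instance Definition _ :=
  SubChoice_isSubGroup.Build alg_aut is_diag Diag is_diag_group_closed.

End AlgebraAutomorphisms.

Section FieldUnits.
Variable F : fieldType.

Definition field_units := {x : F | x != 0}.

HB.instance Definition _ := SubChoice.on field_units.

Implicit Types x y : field_units.

Fact field_units_mul_subproof x y : val x * val y != 0.
Proof. by rewrite mulf_neq0 ?(valP x) ?(valP y). Qed.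
Fact field_units_inv_subproof x : (val x)^-1 != 0.
Proof. by rewrite invr_eq0 (valP x). Qed.

Definition field_units_one : field_units := Sub (1 : F) (oner_neq0 F).
Definition field_units_mul x y : field_units :=
  Sub (val x * val y) (field_units_mul_subproof x y).
Definition field_units_inv x : field_units :=
  Sub (val x)^-1 (field_units_inv_subproof x).

Fact field_units_mulA : associative field_units_mul.
Proof. by move=> x y z; apply: val_inj; rewrite /= mulrA. Qed.
Fact field_units_mul1 : left_id field_units_one field_units_mul.
Proof. by move=> x; apply: val_inj; rewrite /= mul1r. Qed.
Fact field_units_1mul : right_id field_units_one field_units_mul.
Proof. by move=> x; apply: val_inj; rewrite /= mulr1. Qed.
Fact field_units_mulV :
  left_inverse field_units_one field_units_inv field_units_mul.
Proof. by move=> x; apply: val_inj; rewrite /= mulVf ?(valP x). Qed.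
Fact field_units_Vmul :
  right_inverse field_units_one field_units_inv field_units_mul.
Proof. by move=> x; apply: val_inj; rewrite /= mulfV ?(valP x). Qed.

HB.instance Definition _ := isGroup.Build field_units
  field_units_mulA field_units_mul1 field_units_1mul
  field_units_mulV field_units_Vmul.

End FieldUnits.

(* Main.v *)
(* Fix a homogeneous basis b_0, ..., b_(k-1) of V with degrees e_i, and write
   endomorphisms as matrices over D.  By the fine condition a homogeneous
   endomorphism is either diagonal or has a single nonzero entry, so for
   lam_i in F^* with lam_0 = 1 and f in Diag(Gamma_0) the automorphism
   (r_ij) |-> (lam_i / lam_j f(r_ij)) lies in Diag(Gamma).  Conversely, psi in
   Diag(Gamma) stabilises each E_ij D; f is read off the corner E_00 D, lam_i
   off E_i0, and E_ij d = E_i0 (E_00 d) E_0j shows that psi has the above form. *)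
Require Import Defs.
From HB Require Import structures.
From mathcomp Require Import all_boot all_order all_algebra.
From mathcomp Require Import boolp functions.

Set Implicit Arguments.
Unset Strict Implicit.
Unset Printing Implicit Defensive.

Import GRing.Theory.
Local Open Scope ring_scope.

(** * Homogeneous components and projections in a graded abelian group *)

Lemma eq_sum_uniq_sub (I : eqType) (W : nmodType) (s t : seq I) (x : I -> W) :
  uniq s -> uniq t -> {subset s <= t} -> (forall i, i \notin s -> x i = 0) ->
  \sum_(i <- s) x i = \sum_(i <- t) x i.
Proof.
move=> us ut st x0; rewrite [RHS](bigID (mem s)) /= [X in _ = _ + X]big1 //.
rewrite addr0 -[RHS]big_filter; apply: perm_big.
apply: uniq_perm; rewrite ?filter_uniq // => i.
by rewrite mem_filter andb_idr // => /st.
Qed.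

Section HomogeneousComponents.
Variables (G W : zmodType) (W_ : G -> {pred W}) (dW : is_direct_sum W_).

Lemma homog0 g : 0 \in W_ g.
Proof. by case: dW => zW _ _; case: (zW g). Qed.

Lemma homogB g u v : u \in W_ g -> v \in W_ g -> u - v \in W_ g.
Proof. by case: dW => zW _ _; case: (zW g) => _; apply. Qed.

Lemma homogN g v : v \in W_ g -> - v \in W_ g.
Proof. by rewrite -sub0r; apply: homogB; exact: homog0. Qed.

Lemma homogD g u v : u \in W_ g -> v \in W_ g -> u + v \in W_ g.
Proof. by move=> ug vg; rewrite -[v]opprK; apply: homogB => //; apply: homogN. Qed.

Lemma homogMn g v n : v \in W_ g -> v *+ n \in W_ g.
Proof.
by move=> vg; elim: n => [|n IHn]; rewrite ?mulrS ?homogD // mulr0n homog0.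
Qed.

Lemma homog_sum g (I : Type) (s : seq I) (x : I -> W) :
  (forall i, x i \in W_ g) -> \sum_(i <- s) x i \in W_ g.
Proof.
by move=> xg; elim/big_ind: _ => //; [exact: homog0 | exact: homogD].
Qed.

(** The list supplied by [is_direct_sum] may repeat degrees. Removing duplicates and multiplying
    each term by its multiplicity keeps the sum, and this factor also makes the family vanish off
    the list. *)
Lemma homog_decomposition w : exists sx : seq G * (G -> W),
  [/\ uniq sx.1, forall g, sx.2 g \in W_ g, forall g, g \notin sx.1 -> sx.2 g = 0
    & w = \sum_(g <- sx.1) sx.2 g].
Proof.
case: dW => _ /(_ w)[s [x [xW ->]]] _.
exists (undup s, fun g => x g *+ count_mem g s); split=> /=.
- exact: undup_uniq.
- by move=> g; apply: homogMn.
- by move=> g; rewrite mem_undup => /count_memPn ->.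
rewrite -big_undup_iterop_count; apply: eq_bigr => g _.
by rewrite Monoid.iteropE; elim: (count _ _) => [|m IHm] /=; rewrite ?mulrS ?IHm.
Qed.

(** Both are read off one decomposition fixed by choice; [homog_supp w] may contain degrees whose
    component is zero, so it only bounds the true support. *)
Definition homog_supp w : seq G := (projT1 (cid (homog_decomposition w))).1.
Definition homog_proj g w : W := (projT1 (cid (homog_decomposition w))).2 g.

Lemma homog_supp_uniq w : uniq (homog_supp w).
Proof. by rewrite /homog_supp; case: cid => ? []. Qed.

Lemma homog_proj_in g w : homog_proj g w \in W_ g.
Proof. by rewrite /homog_proj; case: cid => ? []. Qed.

Lemma homog_proj_notin g w : g \notin homog_supp w -> homog_proj g w = 0.
Proof. by rewrite /homog_proj /homog_supp; case: cid => ? [] /= _ _ + _; apply. Qed.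

Lemma homog_proj_sum w : w = \sum_(g <- homog_supp w) homog_proj g w.
Proof. by rewrite /homog_proj /homog_supp; case: cid => ? []. Qed.

Lemma homog_sum0 (s : seq G) (x : G -> W) g :
  uniq s -> (forall g, x g \in W_ g) -> (forall g, g \notin s -> x g = 0) ->
  \sum_(g <- s) x g = 0 -> x g = 0.
Proof.
case: dW => _ _ free us xW x0 /(free _ _ us xW) xs.
by have [/xs|/x0] := boolP (g \in s).
Qed.

(** The chosen decomposition and the given one are padded by zeros to a common list [t]; their
    difference is a decomposition of 0, whose terms vanish by directness. *)
Lemma homog_proj_uniq (s : seq G) (x : G -> W) g :
  uniq s -> (forall g, x g \in W_ g) -> (forall g, g \notin s -> x g = 0) ->
  homog_proj g (\sum_(g <- s) x g) = x g.
Proof.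
move=> us xW x0; set w := \sum_(g <- s) x g.
apply/eqP; rewrite -subr_eq0; apply/eqP.
pose t := undup (homog_supp w ++ s).
apply: (@homog_sum0 t (fun g => homog_proj g w - x g)).
- exact: undup_uniq.
- by move=> h; apply: homogB => //; exact: homog_proj_in.
- move=> h; rewrite mem_undup mem_cat negb_or => /andP[hw hs].
  by rewrite homog_proj_notin // x0 // subrr.
have ut : uniq t by exact: undup_uniq.
rewrite sumrB -(@eq_sum_uniq_sub _ _ (homog_supp w)) ?homog_supp_uniq //;
  last 2 first.
- by move=> h hw; rewrite mem_undup mem_cat hw.
- by move=> h; apply: homog_proj_notin.
rewrite -homog_proj_sum -(@eq_sum_uniq_sub _ _ s) // ?subrr // => h hs.
by rewrite mem_undup mem_cat hs orbT.
Qed.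

Lemma homog_proj_id g w : w \in W_ g -> homog_proj g w = w.
Proof.
move=> wg; pose x h := if h == g then w else 0.
have -> : homog_proj g w = homog_proj g (\sum_(h <- [:: g]) x h).
  by rewrite big_seq1 /x eqxx.
rewrite homog_proj_uniq ?/x ?eqxx // => h.
  by case: eqP => [-> //|_]; exact: homog0.
by rewrite inE => /negbTE ->.
Qed.

Lemma homog_projD g u v : homog_proj g (u + v) = homog_proj g u + homog_proj g v.
Proof.
pose s := undup (homog_supp u ++ homog_supp v).
have us : uniq s by exact: undup_uniq.
have e w : {subset homog_supp w <= s} -> w = \sum_(h <- s) homog_proj h w.
  move=> ws; rewrite {1}[w]homog_proj_sum.
  by apply: eq_sum_uniq_sub; rewrite ?homog_supp_uniq // => h /homog_proj_notin.
have -> : u + v = \sum_(h <- s) (homog_proj h u + homog_proj h v).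
  rewrite big_split /= -!e // => h hw; rewrite mem_undup mem_cat hw //.
  by rewrite orbT.
rewrite homog_proj_uniq // => h; first by rewrite homogD ?homog_proj_in.
rewrite mem_undup mem_cat negb_or => /andP[hu hv].
by rewrite !homog_proj_notin ?addr0.
Qed.

Lemma homog_proj_bigsum g (I : Type) (s : seq I) (x : I -> W) :
  homog_proj g (\sum_(i <- s) x i) = \sum_(i <- s) homog_proj g (x i).
Proof.
by apply: (big_morph _ (homog_projD g)); apply: homog_proj_id; exact: homog0.
Qed.

Lemma homog_ind (P : W -> Prop) :
  P 0 -> (forall u v, P u -> P v -> P (u + v)) ->
  (forall g w, w \in W_ g -> P w) -> forall w, P w.
Proof.
move=> P0 PD Pg w; rewrite [w]homog_proj_sum.
by elim/big_ind: _ => // g _; apply: (Pg g); exact: homog_proj_in.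
Qed.

End HomogeneousComponents.

(** Applying [f] termwise to the decomposition of [w] and reindexing by [h + l] yields a
    decomposition of [f w], which is unique. It serves for left multiplication in [D] and for the
    action of [D] on a homogeneous vector. *)
Lemma homog_proj_shift (G W W' : zmodType) (W_ : G -> {pred W})
    (W'_ : G -> {pred W'}) (dW : is_direct_sum W_) (dW' : is_direct_sum W'_)
    (h : G) (f : W -> W') :
  {morph f : u v / u + v} ->
  (forall g w, w \in W_ g -> f w \in W'_ (h + g)) ->
  forall g w, homog_proj dW' (h + g) (f w) = f (homog_proj dW g w).
Proof.
move=> fD fW g w.
have f0 : f 0 = 0 by apply: (@addrI _ (f 0)); rewrite -fD !addr0.
have -> : f w = \sum_(k <- [seq h + l | l <- homog_supp dW w])
    f (homog_proj dW (k - h) w).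
  rewrite big_map {1}(homog_proj_sum dW w) (big_morph f fD f0).
  by apply: eq_bigr => l _; rewrite addrAC subrr add0r.
rewrite homog_proj_uniq.
- by rewrite addrAC subrr add0r.
- by rewrite map_inj_uniq ?homog_supp_uniq //; exact: addrI.
- move=> l; have := fW _ _ (homog_proj_in dW (l - h) w).
  by rewrite addrCA subrr addr0.
move=> l; apply: contraNeq => fl; apply/mapP; exists (l - h).
  by apply: contraNT fl => /homog_proj_notin ->; rewrite f0.
by rewrite addrCA subrr addr0.
Qed.

(** * Graded-division algebras: homogeneous inverses, and the support as a subgroup *)

Lemma algebra_direct_sum (G : zmodType) (F : fieldType) (D : algType F)
  (D_ : G -> {pred D}) : is_algebra_grading D_ -> is_direct_sum D_.
Proof. by case. Qed.

Lemma module_direct_sum (G : zmodType) (F : fieldType) (D : algType F)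
    (V : lmodType D^c) (D_ : G -> {pred D}) (V_ : G -> {pred V}) :
  is_module_grading D_ V_ -> is_direct_sum V_.
Proof. by case. Qed.

Section GradedDivision.
Variables (G : zmodType) (F : fieldType) (D : algType F) (D_ : G -> {pred D}).
Variables (hD : is_algebra_grading D_) (hdiv : is_graded_division D_).

Local Notation dD := (algebra_direct_sum hD).

Lemma grading_mul g h x y : x \in D_ g -> y \in D_ h -> x * y \in D_ (g + h).
Proof. by case: hD => _ _; apply. Qed.

Lemma grading_proj_mul g h x y :
  x \in D_ g -> homog_proj dD (g + h) (x * y) = x * homog_proj dD h y.
Proof.
move=> xg; apply: (@homog_proj_shift _ _ _ _ _ dD dD g ( *%R x)).
  by move=> u v; rewrite mulrDr.
by move=> l z zl; apply: grading_mul.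
Qed.

(** The degree 0 component of 1 is a right identity: for [x] of degree [g], multiplying it by that
    component gives the degree [g] part of [x * 1]. Taking [x = 1] identifies it with 1. *)
Lemma grading1 : 1 \in D_ 0.
Proof.
suff <- : homog_proj dD 0 1 = 1 by exact: homog_proj_in.
suff e x : x * homog_proj dD 0 1 = x by rewrite -[LHS]mul1r e.
elim/(homog_ind dD): x => [|u v eu ev|g x xg]; first by rewrite mul0r.
  by rewrite mulrDl eu ev.
by rewrite -(grading_proj_mul _ _ xg) mulr1 addr0 homog_proj_id.
Qed.

(** If [y] inverts [x], then [x] times the degree [- g] component of [y] is the degree 0 component
    of [x * y = 1], so that component is itself an inverse and equals [y]. *)
Lemma homog_inverse g x : x \in D_ g -> x != 0 ->
  exists2 y, y \in D_ (- g) & x * y = 1 /\ y * x = 1.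
Proof.
move=> xg x0; have [y [xy yx]] := hdiv xg x0.
exists y => //; suff <- : homog_proj dD (- g) y = y by exact: homog_proj_in.
rewrite -[LHS]mul1r -yx -mulrA -(grading_proj_mul _ _ xg) subrr xy.
by rewrite homog_proj_id ?mulr1 //; exact: grading1.
Qed.

Lemma in_support0 : in_support D_ 0.
Proof. by exists 1; [exact: grading1 | exact: oner_neq0]. Qed.

Lemma in_supportN g : in_support D_ g -> in_support D_ (- g).
Proof.
move=> [x xg x0]; have [y yg [xy _]] := homog_inverse xg x0.
exists y => //; apply: contra_eq_neq xy => ->.
by rewrite mulr0 eq_sym oner_neq0.
Qed.

Lemma in_supportD g h : in_support D_ g -> in_support D_ h -> in_support D_ (g + h).
Proof.
move=> [x xg x0] [y yh y0]; have [z _ [_ zx]] := homog_inverse xg x0.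
exists (x * y); first exact: grading_mul.
by apply: contraNneq y0 => xy0; rewrite -[y]mul1r -zx -mulrA xy0 mulr0.
Qed.

Lemma in_supportB g h : in_support D_ g -> in_support D_ h -> in_support D_ (g - h).
Proof. by move=> sg /in_supportN; apply: in_supportD. Qed.

End GradedDivision.

(** * Elementary identities for the right action and for algebra automorphisms *)

Section RightAction.
Variables (F : fieldType) (D : algType F) (V : lmodType D^c).
Implicit Types (u v : V) (d : D).

Lemma ractA v d d' : v *r d *r d' = v *r (d * d').
Proof. by rewrite /ract scalerA. Qed.

Lemma ract1 v : v *r 1 = v.
Proof. exact: scale1r. Qed.

Lemma ract0 v : v *r 0 = 0.
Proof. exact: scale0r. Qed.

Lemma ractDr v d d' : v *r (d + d') = v *r d + v *r d'.
Proof. exact: scalerDl. Qed.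

Lemma ract_suml (I : finType) (v : I -> V) d :
  (\sum_i v i) *r d = \sum_i v i *r d.
Proof. exact: scaler_sumr. Qed.

End RightAction.

Section AlgAutTheory.
Variables (F : fieldType) (A : algType F) (f : alg_aut A).

Lemma alg_autD x y :
  val f (x + y) = val f x + val f y.
Proof.
by have [lf _ _] := alg_autP f; rewrite -[x]scale1r lf alg_autZ !scale1r.
Qed.

Lemma alg_autM x y :
  val f (x * y) = val f x * val f y.
Proof. by have [_ [_ fM] _] := alg_autP f; rewrite fM. Qed.

Lemma alg_aut1 : val f 1 = 1.
Proof. by have [_ [f1 _] _] := alg_autP f. Qed.

Lemma alg_aut0 : val f 0 = 0.
Proof. by rewrite -(scale0r 0) alg_autZ !scale0r. Qed.

Lemma alg_aut_bigsum (I : finType) (x : I -> A) :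
  val f (\sum_i x i) = \sum_i val f (x i).
Proof. by apply: (big_morph _ alg_autD); exact: alg_aut0. Qed.

End AlgAutTheory.

(** * Endomorphisms as matrices over [D] in a fixed basis *)

Section Coordinates.
Variables (F : fieldType) (D : algType F) (V : lmodType D^c) (k : nat).
Variables (b : 'I_k -> V).
Hypothesis basis_b :
  forall w : V, exists! d : {ffun 'I_k -> D}, w = \sum_(i < k) b i *r d i.

Definition bcoord (v : V) : 'I_k -> D := projT1 (cid (basis_b v)).

Lemma bcoord_sum v : v = \sum_(i < k) b i *r bcoord v i.
Proof. by rewrite /bcoord; case: cid => d []. Qed.

Lemma bcoord_uniq (d : 'I_k -> D) i : bcoord (\sum_(i < k) b i *r d i) i = d i.
Proof.
rewrite /bcoord; case: cid => d' [_ uniq_d'] /=.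
rewrite (uniq_d' (finfun d)) ?ffunE //.
by apply: eq_bigr => j _; rewrite ffunE.
Qed.

Lemma bcoord_inj u v : bcoord u =1 bcoord v -> u = v.
Proof.
by move=> e; rewrite (bcoord_sum u) (bcoord_sum v); under eq_bigr do rewrite e.
Qed.

Lemma bcoordD u v i : bcoord (u + v) i = bcoord u i + bcoord v i.
Proof.
rewrite -(bcoord_uniq (fun i => bcoord u i + bcoord v i)); congr bcoord.
rewrite {1}(bcoord_sum u) {1}(bcoord_sum v) -big_split /=.
by apply: eq_bigr => j _; rewrite ractDr.
Qed.

Lemma bcoord_ract v d i : bcoord (v *r d) i = bcoord v i * d.
Proof.
rewrite -(bcoord_uniq (fun i => bcoord v i * d)); congr bcoord.
rewrite {1}(bcoord_sum v) ract_suml.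
by apply: eq_bigr => j _; rewrite ractA.
Qed.

Lemma bcoord0 i : bcoord 0 i = 0.
Proof. by rewrite -[in LHS](ract0 (0 : V)) bcoord_ract mulr0. Qed.

Lemma bcoord_bigsum (I : finType) (v : I -> V) i :
  bcoord (\sum_j v j) i = \sum_j bcoord (v j) i.
Proof.
by apply: (big_morph (bcoord^~ i) (fun u w => bcoordD u w i)); exact: bcoord0.
Qed.

Lemma bcoord_basis i j : bcoord (b i) j = (i == j)%:R.
Proof.
rewrite -(bcoord_uniq (fun j => (i == j)%:R)); congr bcoord.
rewrite (bigD1 i) //= eqxx ract1 big1 ?addr0 // => l.
by rewrite eq_sym => /negbTE ->; rewrite ract0.
Qed.

Lemma basis_neq0 i : b i != 0.
Proof.
apply/eqP => bi0; have := bcoord_basis i i; rewrite bi0 bcoord0 eqxx.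
by move/eqP; rewrite eq_sym oner_eq0.
Qed.

Variable V_neq0 : exists v : V, v != 0.
Local Notation R := (endD V_neq0).
Implicit Types r : R.

Lemma endD_ract r v d : val r (v *r d) = val r v *r d.
Proof. exact: endD_scalef. Qed.

Lemma endD_bigsum r (I : finType) (v : I -> V) :
  val r (\sum_i v i) = \sum_i val r (v i).
Proof.
apply: (big_morph _ (endD_addf r)).
by rewrite -[X in val r X](ract0 (0 : V)) endD_ract ract0.
Qed.

Lemma endD_valD r r' v : val (r + r') v = val r v + val r' v.
Proof. by rewrite raddfD. Qed.

Definition entry r (i j : 'I_k) : D := bcoord (val r (b j)) i.

(** Scalars act on the right of [V], so entries multiply coordinates from the left and composition
    becomes the usual matrix product over the possibly noncommutative [D]. *)
Lemma bcoord_endD r v i : bcoord (val r v) i = \sum_j entry r i j * bcoord v j.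
Proof.
rewrite {1}(bcoord_sum v) endD_bigsum bcoord_bigsum.
by apply: eq_bigr => j _; rewrite endD_ract bcoord_ract.
Qed.

Lemma entry_inj r r' : entry r =2 entry r' -> r = r'.
Proof.
move=> e; apply: endD_eq => v; apply: bcoord_inj => i.
by rewrite !bcoord_endD; apply: eq_bigr => j _; rewrite e.
Qed.

Lemma entryD r r' i j : entry (r + r') i j = entry r i j + entry r' i j.
Proof. by rewrite /entry endD_valD bcoordD. Qed.

Lemma entryZ c r i j : entry (c *: r) i j = c *: entry r i j.
Proof.
rewrite /entry -[val (c *: r) _]/(val r (b j) *r c%:A) bcoord_ract.
by rewrite mulr_algr.
Qed.

Lemma entry1 i j : entry 1 i j = (i == j)%:R.
Proof. by rewrite /entry bcoord_basis eq_sym. Qed.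

Lemma entryM r r' i j : entry (r * r') i j = \sum_l entry r i l * entry r' l j.
Proof. by rewrite -bcoord_endD. Qed.

Fact endD_of_subproof (a : 'I_k -> 'I_k -> D) :
  (fun v => \sum_i b i *r (\sum_j a i j * bcoord v j)) \in @D_linear F D V.
Proof.
apply/asboolP => d u v; rewrite scaler_sumr -big_split /=.
apply: eq_bigr => i _; rewrite -[d *: (b i *r _)]/(_ *r (d : D)) ractA -ractDr.
congr (_ *r _); rewrite mulr_suml -big_split /=; apply: eq_bigr => j _.
by rewrite -mulrA -mulrDr bcoordD -[d *: u]/(u *r (d : D)) bcoord_ract.
Qed.

Definition endD_of a : R :=
  Sub (fun v => \sum_i b i *r (\sum_j a i j * bcoord v j)) (endD_of_subproof a).

Lemma entry_of a i j : entry (endD_of a) i j = a i j.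
Proof.
rewrite /entry bcoord_uniq (bigD1 j) //= bcoord_basis eqxx mulr1 big1 ?addr0 //.
by move=> l; rewrite bcoord_basis eq_sym => /negbTE ->; rewrite mulr0.
Qed.

(* The conjugate of f, applied entrywise, by the diagonal matrix lam. *)
Definition twist (lam : 'I_k -> F) (f : D -> D) r : R :=
  endD_of (fun i j => (lam i / lam j) *: f (entry r i j)).

Lemma entry_twist lam f r i j :
  entry (twist lam f r) i j = (lam i / lam j) *: f (entry r i j).
Proof. exact: entry_of. Qed.

(** This one identity provides both the inverse of a twist and the multiplicativity of the twist in
    the pair ([lam], [f]). *)
Lemma twist_comp (lam lam' : 'I_k -> F) (f f' : D -> D) r :
  (forall i, lam i != 0) -> scalable f ->
  twist lam f (twist lam' f' r) = twist (fun i => lam i * lam' i) (f \o f') r.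
Proof.
move=> lam0 fZ; apply: entry_inj => i j; rewrite !entry_twist /= fZ scalerA.
by congr (_ *: _); rewrite invfM [in RHS]mulrACA.
Qed.

Lemma twist_id (lam : 'I_k -> F) f r :
  (forall i, lam i = 1) -> f =1 id -> twist lam f r = r.
Proof.
move=> lam1 f1; apply: entry_inj => i j.
by rewrite entry_twist !lam1 divr1 scale1r f1.
Qed.

(** Products are preserved because the ratios telescope: [(lam i / lam l) * (lam l / lam j) = lam i
    / lam j]. The inverse is the twist by the inverse scalars and the inverse of [f]. *)
Lemma twist_alg_aut (lam : 'I_k -> F) (f : alg_aut D) :
  (forall i, lam i != 0) -> twist lam (val f) \in @is_alg_aut F R.
Proof.
move=> lam0; apply/asboolP; split.
- move=> c r r'; apply: entry_inj => i j.
  rewrite entry_twist !entryD !entryZ alg_autD alg_autZ !entry_twist scalerDr.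
  by rewrite !scalerA mulrC.
- split=> [|r r']; apply: entry_inj => i j; rewrite entry_twist.
    rewrite !entry1; case: eqP => [->|_]; last by rewrite alg_aut0 scaler0.
    by rewrite alg_aut1 divff // scale1r.
  rewrite !entryM alg_aut_bigsum scaler_sumr; apply: eq_bigr => l _.
  rewrite !entry_twist alg_autM -scalerAl -scalerAr scalerA.
  by rewrite mulrA divfK.
have [_ _ bf] := alg_autP f; have [g [fK gK]] := alg_aut_inv_ex f.
have lamV0 i : (lam i)^-1 != 0 by rewrite invr_eq0.
exists (twist (fun i => (lam i)^-1) (val g)) => r;
  rewrite twist_comp //; try by move=> c x; rewrite alg_autZ.
- by rewrite twist_id // => i; rewrite mulVf.
- by rewrite twist_id // => i; rewrite mulfV.
Qed.

End Coordinates.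

(** Extends the scalar to degrees outside the support, where the component contains only 0 and the
    default scalar 1 works. *)
Lemma is_diag_scalar (G : zmodType) (F : fieldType) (A : algType F)
    (A_ : G -> {pred A}) (f : alg_aut A) g :
  f \in is_diag A_ ->
  exists2 c : F, c != 0 & forall x, x \in A_ g -> val f x = c *: x.
Proof.
move=> /asboolP df; have [/df //|nsg] := pselect (in_support A_ g).
exists 1; first exact: oner_neq0.
move=> x xg; have [->|x0] := eqVneq x 0; first by rewrite alg_aut0 scaler0.
by case: nsg; exists x.
Qed.

(** * Homogeneous bases: degrees of coordinates and entries, and matrix units *)

Section HomogeneousBasis.
Variables (G : zmodType) (F : fieldType) (D : algType F) (D_ : G -> {pred D}).
Variables (V : lmodType D^c) (V_ : G -> {pred V}) (k : nat).
Variables (hD : is_algebra_grading D_) (hdiv : is_graded_division D_).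
Variables (hV : is_module_grading D_ V_) (V_neq0 : exists v : V, v != 0).
Variables (b : 'I_k -> V) (e : 'I_k -> G).
Hypothesis basis_b :
  forall w : V, exists! d : {ffun 'I_k -> D}, w = \sum_(i < k) b i *r d i.
Hypothesis deg_b : forall i, b i \in V_ (e i).

Local Notation R := (endD V_neq0).
Local Notation bcoord := (bcoord basis_b).
Local Notation entry := (entry basis_b).
Local Notation Gamma := (end_grading (V_neq0 := V_neq0) V_).

Local Notation dD := (algebra_direct_sum hD).
Local Notation dV := (module_direct_sum hV).

Lemma homog_ract g h v d : v \in V_ g -> d \in D_ h -> v *r d \in V_ (g + h).
Proof. by case: hV => _; apply. Qed.

Lemma homog_proj_ract g h v d :
  v \in V_ g -> homog_proj dV (g + h) (v *r d) = v *r homog_proj dD h d.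
Proof.
move=> vg; apply: (@homog_proj_shift _ _ _ _ _ dD dV g (ract v)).
  by move=> d1 d2; rewrite ractDr.
by move=> l d'; apply: homog_ract.
Qed.

(** Since [b j] has degree [e j], projecting the expansion of [v] to degree [h] projects its [j]-th
    coordinate to degree [h - e j]; uniqueness of coordinates then gives the direct implication. *)
Lemma homog_coordP h v :
  v \in V_ h <-> forall i, bcoord v i \in D_ (h - e i).
Proof.
split=> [vh i|ch]; last first.
  rewrite (bcoord_sum basis_b v); apply: (homog_sum dV) => i.
  by rewrite -(subrK (e i) h) addrC; apply: homog_ract.
suff -> : bcoord v i = homog_proj dD (h - e i) (bcoord v i) by exact: homog_proj_in.
rewrite -[RHS](bcoord_uniq basis_b (fun j => homog_proj dD (h - e j) (bcoord v j))).
congr (bcoord _ i); rewrite -{1}(homog_proj_id dV vh) {1}(bcoord_sum basis_b v).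
rewrite homog_proj_bigsum; apply: eq_bigr => j _.
by rewrite -(homog_proj_ract _ _ (deg_b j)) addrC subrK.
Qed.

(** Column [j] holds the coordinates of the image of [b j], which lies in degree [g + e j].
    Conversely these degrees add up correctly in the matrix-vector product. *)
Lemma end_gradingP g (r : R) :
  r \in Gamma g <-> forall i j, entry r i j \in D_ (g + e j - e i).
Proof.
split=> [/asboolP rg i j|rg]; first by have /homog_coordP := rg _ _ (deg_b j); apply.
apply/asboolP => h v /homog_coordP ch; apply/homog_coordP => i.
rewrite bcoord_endD; apply: (homog_sum dD) => j.
have -> : g + h - e i = (g + e j - e i) + (h - e j).
  by rewrite [RHS]addrAC [g + e j + _]addrACA subrr addr0.
exact: grading_mul.
Qed.

Definition matrix_unit i j (d : D) : R :=
  endD_of basis_b V_neq0 (fun i' j' => if (i' == i) && (j' == j) then d else 0).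

Lemma entry_unit i j d i' j' :
  entry (matrix_unit i j d) i' j' = if (i' == i) && (j' == j) then d else 0.
Proof. exact: entry_of. Qed.

Lemma unitM i j l d d' :
  matrix_unit i j d * matrix_unit j l d' = matrix_unit i l (d * d').
Proof.
apply: (entry_inj (basis_b := basis_b)) => i' l'; rewrite entryM (bigD1 j) //=.
rewrite big1 ?addr0 => [|j' j'j]; rewrite !entry_unit.
  by rewrite !eqxx andbT; case: eqP; case: eqP; rewrite ?mulr0 ?mul0r.
by rewrite (negbTE j'j) andbF mul0r.
Qed.

Lemma unitD i j d d' :
  matrix_unit i j (d + d') = matrix_unit i j d + matrix_unit i j d'.
Proof.
apply: (entry_inj (basis_b := basis_b)) => i' j'; rewrite entryD !entry_unit.
by case: ifP; rewrite ?addr0.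
Qed.

Lemma unitZ i j c d : matrix_unit i j (c *: d) = c *: matrix_unit i j d.
Proof.
apply: (entry_inj (basis_b := basis_b)) => i' j'; rewrite entryZ !entry_unit.
by case: ifP; rewrite ?scaler0.
Qed.

Lemma unit0 i j : matrix_unit i j 0 = 0.
Proof. by rewrite -(scale0r 0) unitZ scale0r. Qed.

Lemma unit_homog g i j d :
  d \in D_ g -> matrix_unit i j d \in Gamma (g + e i - e j).
Proof.
move=> dg; apply/end_gradingP => i' j'; rewrite entry_unit.
case: ifP => [/andP[/eqP-> /eqP->]|_]; last exact: (homog0 dD).
by rewrite subrK addrK.
Qed.

Lemma endD_sum_unit (r : R) : r = \sum_i \sum_j matrix_unit i j (entry r i j).
Proof.
have entry_sum (I : finType) (x : I -> R) i j :
    entry (\sum_l x l) i j = \sum_l entry (x l) i j.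
  apply: (big_morph (fun r => entry r i j)) => [r1 r2|]; first exact: entryD.
  by rewrite -(scale0r 0) entryZ scale0r.
apply: (entry_inj (basis_b := basis_b)) => i j.
rewrite entry_sum (bigD1 i) //= [X in _ + X]big1 ?addr0 => [|i' i'i];
  rewrite entry_sum.
  rewrite (bigD1 j) //= big1 ?addr0 => [|j' j'j]; rewrite entry_unit ?eqxx //.
  by rewrite eq_sym (negbTE j'j) andbF.
by apply: big1 => j' _; rewrite entry_unit eq_sym (negbTE i'i).
Qed.

Lemma alg_aut_unit_inj (phi psi : alg_aut R) :
  (forall i j d, val phi (matrix_unit i j d) = val psi (matrix_unit i j d)) ->
  phi = psi.
Proof.
move=> eq_unit; apply/val_inj/funext => r; rewrite (endD_sum_unit r).
rewrite !alg_aut_bigsum; apply: eq_bigr => i _.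
by rewrite !alg_aut_bigsum; apply: eq_bigr => j _.
Qed.

Definition twist_aut (lam : 'I_k -> F) (lam0 : forall i, lam i != 0)
  (f : alg_aut D) : alg_aut R :=
  Sub (twist basis_b lam (val f)) (twist_alg_aut basis_b V_neq0 f lam0).

Lemma twist_unit lam f i j d :
  twist basis_b lam (val (f : alg_aut D)) (matrix_unit i j d) =
  matrix_unit i j ((lam i / lam j) *: val f d).
Proof.
apply: (entry_inj (basis_b := basis_b)) => i' j'; rewrite entry_twist !entry_unit.
by case: ifP => [/andP[/eqP-> /eqP->] //|_]; rewrite alg_aut0 scaler0.
Qed.

(** * Twists are diagonal under the fine condition *)

Section FineDegrees.
(** The fine condition carried over from coset representatives to the degrees of the basis;
    [fine_degrees] establishes it. *)
Hypothesis fine_e : forall i j h l, i != j -> (i, j) != (h, l) ->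
  ~ in_support D_ (e i - e j - (e h - e l)).

(** Nonzero entries at both positions would put the degrees [g + e j - e i] and [g + e l - e h] in
    the support, hence also their difference, which [fine_e] forbids. So one off-diagonal entry
    confines the whole component to its position. *)
Lemma entry_homog0 g (r r' : R) i j h l :
  r \in Gamma g -> r' \in Gamma g -> i != j -> (i, j) != (h, l) ->
  entry r i j != 0 -> entry r' h l = 0.
Proof.
move=> /end_gradingP/(_ i j) rg /end_gradingP/(_ h l) r'g ij ijhl rij.
apply/eqP; apply: contra_notT (fine_e ij ijhl) => r'hl.
have -> : e i - e j - (e h - e l) = (g + e l - e h) - (g + e j - e i).
  rewrite -[g + e l - _]addrA -[g + e j - _]addrA (opprD g) [RHS]addrACA.
  by rewrite subrr add0r !opprB addrC.
by apply: (in_supportB hD hdiv); [exists (entry r' h l) | exists (entry r i j)].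
Qed.

Lemma twist_diag lam lam0 (f : alg_aut D) :
  f \in is_diag D_ -> @twist_aut lam lam0 f \in is_diag Gamma.
Proof.
move=> df; apply/asboolP => g [r0 r0g r0_neq0].
(* The dichotomy concerns the whole component of degree [g]: either some element has a nonzero
   off-diagonal entry, and all elements live at that position, or all elements are diagonal. *)
have [[i [j [r [rg ij rij]]]]|diag] :=
    pselect (exists i j r, [/\ r \in Gamma g, i != j & entry r i j != 0]).
  have [c c0 fc] := is_diag_scalar (g + e j - e i) df.
  exists (lam i / lam j * c); first by rewrite !mulf_neq0 ?invr_eq0.
  move=> r' r'g; apply: (entry_inj (basis_b := basis_b)) => h l.
  rewrite entry_twist entryZ.
  have [ijhl|ijhl] := eqVneq (i, j) (h, l); last first.
    by rewrite (entry_homog0 rg r'g ij ijhl rij) alg_aut0 !scaler0.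
  case: ijhl => <- <-; have /end_gradingP/(_ i j)/fc -> := r'g.
  by rewrite scalerA.
have offdiag (r : R) i j : r \in Gamma g -> i != j -> entry r i j = 0.
  move=> rg ij; apply/eqP; apply: contra_notT diag => rij.
  by exists i, j, r.
(* Diagonal entries all lie in [D_ g] and the ratios [lam i / lam i] are 1, so the scalar of [f] on
   [D_ g] serves every position at once. *)
have [c c0 fc] := is_diag_scalar g df; exists c => // r rg.
apply: (entry_inj (basis_b := basis_b)) => i j; rewrite entry_twist entryZ.
have [->|ij] := eqVneq i j; last by rewrite offdiag // alg_aut0 !scaler0.
have /end_gradingP/(_ j j) := rg; rewrite addrK => /fc ->.
by rewrite divff // scale1r.
Qed.

End FineDegrees.
End HomogeneousBasis.

(** * Every diagonal automorphism is a normalised twist, in a unique way *)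

Section DiagonalAutomorphisms.
Variables (G : zmodType) (F : fieldType) (D : algType F) (D_ : G -> {pred D}).
Variables (V : lmodType D^c) (V_ : G -> {pred V}) (n : nat).
Variables (hD : is_algebra_grading D_).
Variables (hV : is_module_grading D_ V_) (V_neq0 : exists v : V, v != 0).
Variables (b : 'I_n.+1 -> V) (e : 'I_n.+1 -> G).
Hypothesis basis_b :
  forall w : V, exists! d : {ffun 'I_n.+1 -> D}, w = \sum_(i < n.+1) b i *r d i.
Hypothesis deg_b : forall i, b i \in V_ (e i).

Local Notation R := (endD V_neq0).
Local Notation entry := (entry basis_b).
Local Notation Gamma := (end_grading (V_neq0 := V_neq0) V_).
Local Notation E := (matrix_unit V_neq0 basis_b).

Local Notation dD := (algebra_direct_sum hD).

Lemma unit_inj i j : injective (E i j).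
Proof.
move=> d d' /(congr1 (fun r => entry r i j)).
by rewrite !entry_unit !eqxx.
Qed.

Section OneAutomorphism.
Variables (phi : alg_aut R) (phi_diag : phi \in is_diag Gamma).

(** The element [E i j d] is homogeneous of degree [g + e i - e j], so the scalar depends on [g],
    [i], [j] but not on [d]. *)
Lemma diag_unit g i j :
  exists2 c : F, c != 0 & forall d, d \in D_ g -> val phi (E i j d) = c *: E i j d.
Proof.
have [c c0 phiE] := is_diag_scalar (g + e i - e j) phi_diag.
exists c => // d dg; apply: phiE.
by have := @unit_homog _ _ _ _ _ _ _ hD hV V_neq0 _ _ basis_b deg_b g i j d dg.
Qed.

Lemma diag_unit1 i j :
  exists2 c : F, c != 0 & val phi (E i j 1) = c *: E i j 1.
Proof.
have [c c0 phiE] := diag_unit 0 i j; exists c => //.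
by apply: phiE; exact: grading1.
Qed.

(** [E i i 1] is idempotent, so its scalar satisfies [c * c = c] with [c] nonzero, whence
    [c = 1]. *)
Lemma diag_unit_ii i : val phi (E i i 1) = E i i 1.
Proof.
have [c c0 phiE] := diag_unit1 i i.
have := alg_autM phi (E i i 1) (E i i 1).
rewrite unitM mulr1 phiE -scalerAl -scalerAr unitM mulr1 -!unitZ.
move=> /unit_inj/(scalerI c0); rewrite -{1}(scale1r 1) => /eqP.
rewrite -subr_eq0 -scalerBl scaler_eq0 oner_eq0 orbF subr_eq0 => /eqP <-.
by rewrite scale1r.
Qed.

Definition corner (d : D) : D := entry (val phi (E ord0 ord0 d)) ord0 ord0.

(** Homogeneous parts of [d] may be scaled by different factors, so stability of the corner is
    checked on homogeneous elements and extended by additivity. *)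
Lemma corner_unit d : val phi (E ord0 ord0 d) = E ord0 ord0 (corner d).
Proof.
have eE x : val phi (E ord0 ord0 d) = E ord0 ord0 x ->
    val phi (E ord0 ord0 d) = E ord0 ord0 (corner d).
  by rewrite /corner => ->; rewrite entry_unit !eqxx.
suff [x /eE] : exists x, val phi (E ord0 ord0 d) = E ord0 ord0 x by [].
elim/(homog_ind dD): d {eE} => [|u v [x ux] [y vy]|g d dg].
- by exists 0; rewrite unit0 alg_aut0.
- by exists (x + y); rewrite !unitD alg_autD ux vy.
have [c _ /(_ d dg) ->] := diag_unit g ord0 ord0.
by exists (c *: d); rewrite unitZ.
Qed.

End OneAutomorphism.

Lemma corner_comp (phi psi : alg_aut R) d :
  phi \in is_diag Gamma -> psi \in is_diag Gamma ->
  corner (phi * psi)%g d = corner phi (corner psi d).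
Proof.
move=> dphi dpsi; rewrite [LHS]/corner.
rewrite -[val (phi * psi)%g _]/(val phi (val psi _)).
by rewrite (corner_unit dpsi).
Qed.

Lemma corner_id d : corner 1%g d = d.
Proof. by rewrite /corner entry_unit !eqxx. Qed.

(** The corner of [E ord0 ord0 1] is a copy of [D]. Its identity is fixed by [phi], so [phi]
    restricts there to a unital automorphism. *)
Lemma corner_alg_aut (phi : alg_aut R) :
  phi \in is_diag Gamma -> corner phi \in @is_alg_aut F D.
Proof.
move=> dphi; apply/asboolP; split.
- move=> c u v; apply: (@unit_inj ord0 ord0); rewrite -corner_unit //.
  by rewrite !unitD !unitZ alg_autD alg_autZ !corner_unit.
- split=> [|u v]; apply: (@unit_inj ord0 ord0); rewrite -corner_unit //.
    by rewrite diag_unit_ii.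
  by rewrite -[E _ _ (u * v)](unitM _ _ _ ord0) alg_autM !corner_unit // unitM.
(* The inverse map is the corner of [phi^-1], which is again diagonal. *)
have [d1 dB] := is_diag_group_closed Gamma.
have dphiV : phi^-1%g \in is_diag Gamma by rewrite -[phi^-1%g]mul1g; apply: dB.
by exists (corner phi^-1%g) => d; rewrite -corner_comp // ?mulgV ?mulVg corner_id.
Qed.

Lemma diag_twist (phi : alg_aut R) : phi \in is_diag Gamma ->
  exists (lam : 'I_n.+1 -> F) (lam0 : forall i, lam i != 0) (f : alg_aut D),
    [/\ lam ord0 = 1, f \in is_diag D_ & phi = twist_aut V_neq0 basis_b lam0 f].
Proof.
move=> dphi.
have exlam i : exists c : F, c != 0 /\ val phi (E i ord0 1) = c *: E i ord0 1.
  by have [c] := diag_unit1 dphi i ord0; exists c.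
have [lam lamP] := choice exlam.
have lam0 i : lam i != 0 by case: (lamP i).
have unit1_neq0 i j : E i j 1 != 0.
  apply/eqP; rewrite -(unit0 V_neq0 basis_b i j) => /unit_inj/eqP.
  by rewrite oner_eq0.
have scal_inj (c c' : F) i j : c *: E i j 1 = c' *: E i j 1 -> c = c'.
  move=> /eqP; rewrite -subr_eq0 -scalerBl scaler_eq0 (negbTE (unit1_neq0 i j)).
  by rewrite orbF subr_eq0 => /eqP.
(* [E ord0 j 1 * E j ord0 1] is the fixed idempotent [E ord0 ord0 1], so the two scalars are inverse
   to each other. *)
have lamV j : val phi (E ord0 j 1) = (lam j)^-1 *: E ord0 j 1.
  have [c c0 phiE] := diag_unit1 dphi ord0 j; rewrite phiE; congr (_ *: _).
  have := alg_autM phi (E ord0 j 1) (E j ord0 1).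
  rewrite unitM mulr1 diag_unit_ii // phiE (lamP j).2 -scalerAl -scalerAr unitM mulr1.
  rewrite scalerA -[LHS]scale1r => /scal_inj clam.
  by rewrite -[c]mulr1 -(mulfV (lam0 j)) mulrA -clam mul1r.
pose f : alg_aut D := Sub (corner phi) (corner_alg_aut dphi).
exists lam, lam0, f; split.
- apply: (@scal_inj _ _ ord0 ord0); rewrite scale1r.
  by rewrite -(lamP ord0).2 diag_unit_ii.
- apply/asboolP => g _; have [c c0 phiE] := diag_unit dphi g ord0 ord0.
  exists c => // d dg; apply: (@unit_inj ord0 ord0).
  by rewrite -[val f d]/(corner phi d) -corner_unit // phiE // unitZ.
apply: (alg_aut_unit_inj (basis_b := basis_b)) => i j d.
rewrite [RHS]twist_unit -[val f d]/(corner phi d).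
(* The three factors have known images, contributing [lam i], the corner map and [(lam j)^-1]. *)
have -> : E i j d = E i ord0 1 * E ord0 ord0 d * E ord0 j 1.
  by rewrite !unitM mulr1 mul1r.
rewrite !alg_autM (lamP i).2 lamV corner_unit // -!scalerAl -scalerAr !unitM.
by rewrite mul1r mulr1 scalerA unitZ.
Qed.

(** Only ratios of the scalars enter a twist; normalising at [ord0] removes the common factor. Then
    the unit at [(i, ord0)] with [d = 1] recovers [lam i], and the corner recovers [f]. *)
Lemma twist_aut_inj (lam lam' : 'I_n.+1 -> F) (lam0 : forall i, lam i != 0)
    (lam'0 : forall i, lam' i != 0) (f f' : alg_aut D) :
  lam ord0 = 1 -> lam' ord0 = 1 ->
  twist_aut V_neq0 basis_b lam0 f = twist_aut V_neq0 basis_b lam'0 f' ->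
  lam =1 lam' /\ f = f'.
Proof.
move=> lam1 lam'1 /(congr1 val) /= eq_twist.
have eqE i j d : (lam i / lam j) *: val f d = (lam' i / lam' j) *: val f' d.
  by apply: (@unit_inj i j); rewrite -!twist_unit eq_twist.
split=> [i|].
  have := eqE i ord0 1; rewrite lam1 lam'1 !divr1 !alg_aut1 => /eqP.
  by rewrite -subr_eq0 -scalerBl scaler_eq0 oner_eq0 orbF subr_eq0 => /eqP.
apply/val_inj/funext => d; have := eqE ord0 ord0 d.
by rewrite lam1 lam'1 divr1 !scale1r.
Qed.

End DiagonalAutomorphisms.

(** * From the fine condition to the degrees of a homogeneous basis *)

Section FineCondition.
Variables (G : zmodType) (F : fieldType) (D : algType F) (D_ : G -> {pred D}).
Variables (V : lmodType D^c) (V_ : G -> {pred V}) (k : nat).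
Variables (hD : is_algebra_grading D_) (hdiv : is_graded_division D_).
Variables (hV : is_module_grading D_ V_).
Variables (b : 'I_k -> V) (e : 'I_k -> G).
Hypothesis basis_b :
  forall w : V, exists! d : {ffun 'I_k -> D}, w = \sum_(i < k) b i *r d i.
Hypothesis deg_b : forall i, b i \in V_ (e i).

Local Notation dD := (algebra_direct_sum hD).
Local Notation dV := (module_direct_sum hV).

Lemma homog_isotypic g h v :
  v \in V_ h -> cong_supp D_ h g -> v \in isotypic D_ V_ g.
Proof.
move=> vh hg; apply/asboolP.
exists [:: h], (fun l => if l == h then v else 0); split.
- by move=> l; rewrite inE => /eqP ->.
- by move=> l; case: eqP => [->|_] //; exact: (homog0 dV).
by rewrite big_seq1 eqxx.
Qed.

(** Two basis vectors in one isotypic component of dimension 1 are multiples of a homogeneous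
    generator by nonzero homogeneous, hence invertible, elements. Each is then a multiple of the
    other, against independence. *)
Lemma isotypic_line_inj g i j : has_dim V_ (isotypic D_ V_ g) 1 ->
  cong_supp D_ (e i) g -> cong_supp D_ (e j) g -> i = j.
Proof.
case=> c [_ /(_ ord0)[g' cg'] cP] ig jg.
have multiple l : cong_supp D_ (e l) g ->
    exists2 x, x \in D_ (e l - g') & b l = c ord0 *r x.
  move=> lg; have [d [bl _]] := cP _ (homog_isotypic (deg_b l) lg).
  (* The coefficient [d ord0] is replaced by its component of degree [e l - g']; projecting [b l] to
     its own degree [e l] shows that this component suffices. *)
  exists (homog_proj dD (e l - g') (d ord0)); first exact: homog_proj_in.
  rewrite -(homog_proj_ract hD hV _ _ cg') addrC subrK.
  by move: bl; rewrite big_ord1 => <-; rewrite (homog_proj_id _ (deg_b l)).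
have [x xi bi] := multiple i ig; have [y yj bj] := multiple j jg.
have x0 : x != 0.
  by apply: contraNneq (basis_neq0 basis_b i) => x0; rewrite bi x0 ract0.
have [z _ [xz _]] := homog_inverse hD hdiv xi x0.
have bji : b j = b i *r (z * y) by rewrite bi ractA mulrA xz mul1r.
apply/eqP; apply: contraT => ij.
have := bcoord_basis basis_b j j; rewrite bji bcoord_ract bcoord_basis.
by rewrite (negbTE ij) mul0r eqxx => /eqP; rewrite eq_sym oner_eq0.
Qed.

(** Sending a basis vector to its isotypic component is injective as the components have dimension
    1, so distinct index pairs stay distinct, and [e m] agrees with its representative modulo the
    support. *)
Lemma fine_degrees : fine_condition D_ V_ ->
  forall i j h l, i != j -> (i, j) != (h, l) ->
    ~ in_support D_ (e i - e j - (e h - e l)).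
Proof.
move=> [s [g [[_ _ g_cover] g_dim g_fine]]].
have ex_s j : exists i, cong_supp D_ (e j) (g i).
  apply: g_cover; exists (b j); last exact: (basis_neq0 basis_b).
  apply: homog_isotypic (deg_b j) _; rewrite /cong_supp subrr.
  exact: in_support0.
have [sigma sigmaP] := choice ex_s.
have sigma_inj : injective sigma.
  move=> i j ij; apply: (isotypic_line_inj (g_dim (sigma i))) => //.
  by rewrite ij.
move=> i j h l ij ijhl sT.
apply: (g_fine (sigma i) (sigma j) (sigma h) (sigma l)).
- by rewrite (inj_eq sigma_inj).
- by apply: contraNneq ijhl => -[/sigma_inj -> /sigma_inj ->].
have subBB (x y z w : G) : (x - y) - (z - w) = (x - z) - (y - w).
  by rewrite !opprB [LHS]addrACA [RHS]addrACA [- y - z]addrC.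
(* [u m] is the error, lying in the support, between [e m] and its representative. The two fourfold
   differences differ by the same combination of errors. *)
pose u m := e m - g (sigma m).
have gE m : g (sigma m) = e m - u m by rewrite /u opprB addrC subrK.
rewrite /cong_supp !gE !(subBB (e _) (u _)) (subBB (e i - e j)).
by do 3!apply: (in_supportB hD hdiv) => //; exact: sigmaP.
Qed.

End FineCondition.

(** * Tuples of nonzero scalars normalised to 1 at index 0 *)

Section ExtendByOne.
Variables (F : fieldType) (n : nat).

(** Encodes the normalisation at [ord0]: [unlift ord0] returns [None] exactly there, and the other
    indices are the lifts of ['I_n]. *)
Definition extend1 (l : {ffun 'I_n -> field_units F}) (i : 'I_n.+1) : F :=
  if unlift ord0 i is Some j then val (l j) else 1.

Lemma extend1_neq0 l i : extend1 l i != 0.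
Proof.
rewrite /extend1; case: unliftP => [j|] _; first exact: (valP (l j)).
exact: oner_neq0.
Qed.

Lemma extend1_0 l : extend1 l ord0 = 1.
Proof. by rewrite /extend1 unlift_none. Qed.

Lemma extend1_lift l j : extend1 l (lift ord0 j) = val (l j).
Proof. by rewrite /extend1 liftK. Qed.

Lemma extend1_inj l l' : extend1 l =1 extend1 l' -> l = l'.
Proof. by move=> e; apply/ffunP => j; apply/val_inj; rewrite -!extend1_lift e. Qed.

Lemma extend1M l l' i : extend1 (l * l')%g i = extend1 l i * extend1 l' i.
Proof.
by rewrite /extend1; case: unliftP => [j|] _; rewrite ?mulr1 ?ffunE.
Qed.

Lemma extend1_surj (lam : 'I_n.+1 -> F) :
  (forall i, lam i != 0) -> lam ord0 = 1 -> exists l, extend1 l =1 lam.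
Proof.
move=> lam0 lam1; exists [ffun j => Sub (lam (lift ord0 j)) (lam0 _)] => i.
by rewrite /extend1; case: unliftP => [j|] ->; rewrite ?lam1 ?ffunE.
Qed.

End ExtendByOne.

(** * Assembling the isomorphism from the twists *)

Theorem proposition14 (G : zmodType) (F : fieldType)
    (D : algType F) (Gamma0 : G -> {pred D})
    (V : lmodType D^c) (V_ : G -> {pred V}) (k : nat)
    (hD : is_algebra_grading Gamma0) (hdiv : is_graded_division Gamma0)
    (hV : is_module_grading Gamma0 V_) (V_neq0 : exists v : V, v != 0)
    (hk : has_dim V_ predT k) (hfine : fine_condition Gamma0 V_) :
  let Gamma := end_grading (V_neq0 := V_neq0) V_ in
  exists phi : {multiplicative
      Diag Gamma -> {ffun 'I_k.-1 -> field_units F} * Diag Gamma0},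
    bijective phi.
Proof.
move=> Gamma; case: hk => b [_ hom_b basisT].
have basis_b w : exists! d : {ffun 'I_k -> D}, w = \sum_(i < k) b i *r d i.
  exact: basisT.
have [e deg_b] := choice hom_b.
have fine_e := fine_degrees hD hdiv hV basis_b deg_b hfine.
(* An empty basis would force [V] to be zero; otherwise [k = n.+1], [k.-1] is [n], and the index
   [ord0] exists. *)
case: k b e basis_b deg_b fine_e {hom_b basisT} => [|n] b e basis_b deg_b fine_e.
  have [v /eqP[]] := V_neq0.
  by rewrite (bcoord_sum basis_b v) big_ord0.
pose twisted (p : {ffun 'I_n -> field_units F} * Diag Gamma0) :=
  twist_aut V_neq0 basis_b (extend1_neq0 p.1) (val p.2).
have twisted_diag p : twisted p \in is_diag Gamma.
  by apply: (twist_diag hD hdiv hV V_neq0 basis_b deg_b fine_e); exact: valP.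
have twistedM p q : twisted (p * q)%g = (twisted p * twisted q)%g.
  apply/val_inj/funext => r /=.
  rewrite twist_comp => [||c x]; last 2 first.
  - exact: extend1_neq0.
  - by rewrite alg_autZ.
  apply: (entry_inj (basis_b := basis_b)) => i j.
  by rewrite !entry_twist !extend1M.
have twisted_inj : injective twisted.
  move=> [l f] [l' f'] /(twist_aut_inj (extend1_0 _) (extend1_0 _)) /=.
  by case=> /extend1_inj -> ff'; congr (_, _); apply: val_inj.
have twisted_surj (psi : Diag Gamma) : exists p, twisted p = val psi.
  have [lam [lam0 [f [lam1 df ->]]]] := diag_twist hD hV basis_b deg_b (valP psi).
  have [l l_lam] := extend1_surj lam0 lam1.
  exists (l, Sub f df); apply/val_inj/funext => r.
  apply: (entry_inj (basis_b := basis_b)) => i j.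
  by rewrite !entry_twist !l_lam.
(* The desired map is the inverse of [twisted], obtained by choosing preimages; injectivity of
   [twisted] makes it multiplicative. *)
have [phi phiP] := choice twisted_surj.
have phiM : {morph phi : x y / (x * y)%g}.
  by move=> x y; apply: twisted_inj; rewrite twistedM !phiP.
pose phiMM := isMultiplicative.Build _ _ phi phiM.
pose phi_morphism : {multiplicative
    Diag Gamma -> {ffun 'I_n -> field_units F} * Diag Gamma0} :=
  HB.pack phi phiMM.
exists phi_morphism.
exists (fun p => Sub (twisted p) (twisted_diag p)) => [psi|p] /=.
  by apply/val_inj; rewrite /= phiP.
by apply: twisted_inj; rewrite phiP.
Qed.
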